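(* Let $m,n\ge 1$ and let $A=[A_{i,j}]_{i,j=1}^m\in \mathbb{M}_m(\mathbb{M}_n)$ be positive semidefinite. Then both of the following inequalities hold (one for each choice of sign): \[ (\mathrm{tr}\, A)I_{mn} - (\mathrm{tr}_2 A)\otimes I_n \ \ge\ \pm\bigl( I_m\otimes (\mathrm{tr}_1 A) - A\bigr). \]
   Context: $\mathbb{M}_n$ is the set of $n\times n$ complex matrices, $I_n$ is the identity matrix of order $n$. $\mathbb{M}_m(\mathbb{M}_n)$ is the set of complex $mn\times mn$ matrices partitioned into $m\times m$ blocks, each block in $\mathbb{M}_n$; an element is written $A=[A_{i,j}]_{i,j=1}^m$ with $A_{i,j}\in\mathbb{M}_n$. For Hermitian matrices $X,Y$ of the same order, $X\ge Y$ means $X-Y$ is positive semidefinite. The tensor (Kronecker) product of $X=[x_{ij}]$ and $Y$ is the block matrix $X\otimes Y$ whose $(i,j)$-block is $x_{ij}Y$. The partial traces of $A=[A_{i,j}]_{i,j=1}^m\in\mathbb{M}_m(\mathbb{M}_n)$ are $\mathrm{tr}_1 A=\sum_{i=1}^m A_{i,i}\in\mathbb{M}_n$ and $\mathrm{tr}_2 A=[\mathrm{tr}\,A_{i,j}]_{i,j=1}^m\in\mathbb{M}_m$, where $\mathrm{tr}$ is the ordinary trace. *)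

(* Defs.v *)
From mathcomp Require Import all_boot all_order all_algebra.
From mathcomp Require Import complex mxtens reals.

Set Implicit Arguments.
Unset Strict Implicit.
Unset Printing Implicit Defensive.

Import Order.TTheory GRing.Theory Num.Theory.
Local Open Scope ring_scope.
Local Open Scope sesquilinear_scope.

(* The order on R[i] is the one of numClosedFieldType: 0 <= z says that z is
   real and nonnegative. *)
Definition psdmx (R : realType) (k : nat) (A : 'M[R[i]]_k) : Prop :=
  A \is hermsymmx /\ forall x : 'cV[R[i]]_k, 0 <= (x ^t* *m A *m x) 0 0.

(* X >= Y; the relation only holds between Hermitian matrices. *)
Definition loewner_ge (R : realType) (k : nat) (X Y : 'M[R[i]]_k) : Prop :=
  [/\ X \is hermsymmx, Y \is hermsymmx & psdmx (X - Y)].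

(* An m x m block matrix with n x n blocks is a matrix of order m * n; entry
   (k, l) of block (i, j) sits at row i * n + k and column j * n + l, which is
   the indexing that tensmx uses, so that block (i, j) of X *t Y is
   X i j *: Y. *)
Definition blk (R : realType) (m n : nat) (A : 'M[R[i]]_(m * n))
    (i j : 'I_m) : 'M[R[i]]_n :=
  \matrix_(k, l) A (mxtens_index (i, k)) (mxtens_index (j, l)).

Definition ptrace1 (R : realType) (m n : nat) (A : 'M[R[i]]_(m * n)) :
    'M[R[i]]_n :=
  \sum_(i < m) blk A i i.

Definition ptrace2 (R : realType) (m n : nat) (A : 'M[R[i]]_(m * n)) :
    'M[R[i]]_m :=
  \matrix_(i, j) \tr (blk A i j).

Lemma blk_tens (R : realType) (m n : nat) (X : 'M[R[i]]_m) (Y : 'M[R[i]]_n)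
    (i j : 'I_m) : blk (X *t Y) i j = X i j *: Y.
Proof. by apply/matrixP=> k l; rewrite mxE tensmxE mxE. Qed.

(* Main.v *)
Require Import Defs.
From mathcomp Require Import all_boot all_order all_algebra.
From mathcomp Require Import complex mxtens reals.
Import GRing.Theory Num.Theory.
Local Open Scope ring_scope.

(** For a sign [s], let [T_s] be the map [X |-> (tr X) I + s X] on square
matrices. The difference of the two sides of each inequality is a tensor
product of two such maps applied to [A]: since [tr] and the identity on the two
factors produce the partial traces,
[(T_- (x) T_s) A = (tr A) I - (tr_2 A) (x) I + s (I (x) tr_1 A - A)],
with [s = -1] for the sign + of the statement and [s = 1] for the sign -.

Tensoring two maps that preserve positivity need not preserve it, so the
positivity of each [T_s] is not enough. What tensors well is a stronger
property: each [T_s] is the transpose followed by a sum of congruences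
([sum_delta_sym]), namely [2 T_s X] is the sum over [i, j] of [V X^T V^T] with
[V = E_ij + s E_ji]. Transposes and congruences are compatible with tensor
products, so [4 (T_- (x) T_s) A] is a sum of terms [W A^T W^T] with [W] real
([reduction_tensE]). It suffices to check this for [A = X (x) Y], because both
sides are additive and such tensors span ([tens_ind]). As the transpose of a
positive semidefinite matrix is positive semidefinite, so is every term, hence
the sum ([psdmx_reduction_tens]). *)

(** * Matrix units and sums of congruences of the transpose *)

Section MatrixUnits.
Context {K : comNzRingType}.

Lemma mul_delta_mx_mid {n : nat} (i j k l : 'I_n) (Y : 'M[K]_n) :
  delta_mx i j *m Y *m delta_mx k l = Y j k *: delta_mx i l.
Proof.
apply/matrixP=> p q; rewrite mxE (bigD1 k) //= big1 => [|t tk]; last first.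
  by rewrite [delta_mx k l _ _]mxE (negPf tk) mulr0.
rewrite mxE (bigD1 j) //= big1 => [|t tj]; last first.
  by rewrite !mxE (negPf tj) andbF mul0r.
rewrite !mxE !eqxx andbT andTb !addr0.
by case: (p == i); case: (q == l); rewrite ?(mul0r, mulr0, mul1r, mulr1).
Qed.

Lemma sum_delta_diag {n : nat} : \sum_i delta_mx i i = 1%:M :> 'M[K]_n.
Proof.
apply/matrixP=> p q; rewrite summxE mxE (bigD1 p) //= big1 => [|t tp].
  by rewrite mxE eqxx addr0 eq_sym.
by rewrite mxE eq_sym (negPf tp).
Qed.

(** The scalar [(-1) ^+ b] is the sign [s]: [b = true] gives antisymmetric
matrices, [b = false] symmetric ones. *)
Definition delta_sym {n : nat} (b : bool) (i j : 'I_n) : 'M[K]_n :=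
  delta_mx i j + (-1) ^+ b *: delta_mx j i.

(** Expanding the product gives four terms for each [(i, j)]. The two squares
contribute [X_jj E_ii + X_ii E_jj], whose sum is [2 (tr X) I]; the cross terms
contribute [s (X_ij E_ij + X_ji E_ji)], whose sum is [2 s X]. The transpose is
what puts [X_ij], rather than [X_ji], in front of [E_ij]. *)
Lemma sum_delta_sym {n : nat} (b : bool) (X : 'M[K]_n) :
  \sum_i \sum_j delta_sym b i j *m X^T *m (delta_sym b i j)^T
  = (\tr X *: 1%:M + (-1) ^+ b *: X) *+ 2.
Proof.
have trE : \sum_(i < n) \sum_(j < n) X j j *: delta_mx i i
             = \tr X *: 1%:M :> 'M[K]_n.
  under eq_bigr do rewrite -scaler_suml.
  by rewrite -scaler_sumr sum_delta_diag.
pose s : K := (-1) ^+ b.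
have kE (i j : 'I_n) : delta_sym b i j *m X^T *m (delta_sym b i j)^T
  = (X j j *: delta_mx i i + s *: (X i j *: delta_mx i j))
    + (X i i *: delta_mx j j + s *: (X j i *: delta_mx j i)).
  rewrite /delta_sym -/s linearD linearZ /= !trmx_delta !mulmxDl !mulmxDr.
  rewrite -!(scalemxAl, scalemxAr) !mul_delta_mx_mid [s *: (s *: _)]scalerA.
  rewrite -expr2 sqrr_sign scale1r !mxE.
  by rewrite [s *: _ + X i i *: _]addrC.
under eq_bigr do (under eq_bigr do rewrite kE; rewrite big_split).
rewrite big_split /= mulr2n; congr (_ + _); last rewrite exchange_big /=.
  under eq_bigr do rewrite big_split /= -scaler_sumr.
  by rewrite big_split /= trE -scaler_sumr -matrix_sum_delta.
under eq_bigr do rewrite big_split /= -scaler_sumr.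
by rewrite big_split /= trE -scaler_sumr -matrix_sum_delta.
Qed.

(** * Bilinearity of the tensor product, and spanning by elementary tensors *)

Lemma tensmxDl {m n p q : nat} (X X' : 'M[K]_(m, n)) (Y : 'M[K]_(p, q)) :
  (X + X') *t Y = X *t Y + X' *t Y.
Proof. by apply/matrixP=> i j; rewrite !mxE mulrDl. Qed.

Lemma tensmxDr {m n p q : nat} (X : 'M[K]_(m, n)) (Y Y' : 'M[K]_(p, q)) :
  X *t (Y + Y') = X *t Y + X *t Y'.
Proof. by apply/matrixP=> i j; rewrite !mxE mulrDr. Qed.

Lemma tensmxZl {m n p q : nat} (c : K) (X : 'M[K]_(m, n)) (Y : 'M[K]_(p, q)) :
  (c *: X) *t Y = c *: (X *t Y).
Proof. by apply/matrixP=> i j; rewrite !mxE mulrA. Qed.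

Lemma tensmxZr {m n p q : nat} (c : K) (X : 'M[K]_(m, n)) (Y : 'M[K]_(p, q)) :
  X *t (c *: Y) = c *: (X *t Y).
Proof. by apply/matrixP=> i j; rewrite !mxE mulrCA. Qed.

Lemma tensmx_mulrn {m n p q : nat} (X : 'M[K]_(m, n)) (Y : 'M[K]_(p, q)) c d :
  (X *+ c) *t (Y *+ d) = X *t Y *+ (c * d).
Proof.
by apply/matrixP=> i j; rewrite mulmxnE !mxE !mulmxnE mulrnAl mulrnAr mulnC mulrnA.
Qed.

Lemma tensmx_suml {m n p q : nat} (I : finType) (F : I -> 'M[K]_(m, n))
    (Y : 'M[K]_(p, q)) : (\sum_i F i) *t Y = \sum_i F i *t Y.
Proof.
by apply: (big_morph (fun X => X *t Y) (fun X X' => tensmxDl X X' Y) (tens0mx Y)).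
Qed.

Lemma tensmx_sumr {m n p q : nat} (I : finType) (X : 'M[K]_(m, n))
    (F : I -> 'M[K]_(p, q)) : X *t (\sum_i F i) = \sum_i X *t F i.
Proof. by apply: (big_morph (tensmx X) (tensmxDr X) (tensmx0 X)). Qed.

Lemma tens1mx1 {m n : nat} : 1%:M *t 1%:M = 1%:M :> 'M[K]_(m * n).
Proof.
apply/matrixP=> i j; case: (mxtens_indexP i) => a b; case: (mxtens_indexP j) => c d.
rewrite tensmxE !mxE (can_eq (@mxtens_indexK m n)) xpair_eqE.
by case: (a == c); case: (b == d); rewrite ?(mul0r, mulr0, mulr1).
Qed.

Lemma tens_delta {m n : nat} (i j : 'I_m) (k l : 'I_n) :
  delta_mx i j *t delta_mx k l =
  delta_mx (mxtens_index (i, k)) (mxtens_index (j, l)) :> 'M[K]_(m * n).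
Proof.
apply/matrixP=> p q; case: (mxtens_indexP p) => a b; case: (mxtens_indexP q) => c d.
rewrite tensmxE !mxE !(can_eq (@mxtens_indexK m n)) !xpair_eqE andbACA.
by do 2 case: (_ && _); rewrite ?(mul0r, mulr0, mulr1).
Qed.

(** Elementary tensors span because the matrix units of the big matrix space are
tensors of matrix units, the scalar coefficients being absorbed in the first
factor. *)
Lemma tens_ind {m n : nat} (P : 'M[K]_(m * n) -> Prop) :
  P 0 -> (forall A B, P A -> P B -> P (A + B)) ->
  (forall X Y, P (X *t Y)) -> forall A, P A.
Proof.
move=> P0 PD PT A; rewrite [A]matrix_sum_delta.
apply: big_ind => // i _; apply: big_ind => // j _.
case: (mxtens_indexP i) => a b; case: (mxtens_indexP j) => c d.
by rewrite -tens_delta -tensmxZl.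
Qed.

End MatrixUnits.

(** * The difference of the two sides as a tensor product of maps *)

Section PartialTraces.
Context {R : realType} {m n : nat}.
Implicit Types (A B : 'M[R[i]]_(m * n)) (X : 'M[R[i]]_m) (Y : 'M[R[i]]_n).

Lemma blkD A B i j : blk (A + B) i j = blk A i j + blk B i j.
Proof. by apply/matrixP=> k l; rewrite !mxE. Qed.

Lemma blk0 i j : blk (0 : 'M[R[i]]_(m * n)) i j = 0.
Proof. by apply/matrixP=> k l; rewrite !mxE. Qed.

Lemma ptrace1D A B : ptrace1 (A + B) = ptrace1 A + ptrace1 B.
Proof. by rewrite /ptrace1 -big_split; apply: eq_bigr => i _; rewrite blkD. Qed.

Lemma ptrace2D A B : ptrace2 (A + B) = ptrace2 A + ptrace2 B.
Proof. by apply/matrixP=> i j; rewrite !mxE blkD linearD. Qed.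

Lemma ptrace1_0 : ptrace1 (0 : 'M[R[i]]_(m * n)) = 0.
Proof. by rewrite /ptrace1 big1 // => i _; rewrite blk0. Qed.

Lemma ptrace2_0 : ptrace2 (0 : 'M[R[i]]_(m * n)) = 0.
Proof. by apply/matrixP=> i j; rewrite !mxE blk0 linear0. Qed.

Lemma ptrace1_tens X Y : ptrace1 (X *t Y) = \tr X *: Y.
Proof. by rewrite /ptrace1 scaler_suml; apply: eq_bigr => i _; rewrite blk_tens. Qed.

Lemma ptrace2_tens X Y : ptrace2 (X *t Y) = \tr Y *: X.
Proof. by apply/matrixP=> i j; rewrite !mxE blk_tens linearZ mulrC. Qed.

Lemma mxtrace_tens X Y : \tr (X *t Y) = \tr X * \tr Y.
Proof. by rewrite /mxtrace mulr_sum; apply: eq_bigr => i _; rewrite mxE. Qed.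

(** The map [T_- (x) T_s] of the introduction, with [s = (-1) ^+ b]; the
factor [T_-] is known as the reduction map in entanglement theory. *)
Definition reduction_tens (b : bool) A : 'M[R[i]]_(m * n) :=
  \tr A *: 1%:M - ptrace2 A *t 1%:M + (-1) ^+ b *: (1%:M *t ptrace1 A - A).

(** On [X (x) Y] this is the tensor product of two instances of [sum_delta_sym],
with signs [-1] and [s]; each instance contributes a factor 2. *)
Lemma reduction_tensE b A :
  reduction_tens b A *+ 4 =
  \sum_i \sum_j \sum_k \sum_l
    (delta_sym true i j *t delta_sym b k l) *m A^T
      *m (delta_sym true i j *t delta_sym b k l)^T.
Proof.
move: A; apply: tens_ind => [|A B IHA IHB|X Y].
- rewrite /reduction_tens ptrace1_0 ptrace2_0 linear0 tens0mx tensmx0 scale0r.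
  rewrite !subr0 add0r scaler0 mul0rn big1 // => i _.
  do 3! [rewrite big1 // => ? _].
  by rewrite trmx0 mulmx0 mul0mx.
- have -> : reduction_tens b (A + B) = reduction_tens b A + reduction_tens b B.
    rewrite /reduction_tens ptrace1D ptrace2D linearD tensmxDl tensmxDr scalerDl.
    rewrite !opprD (addrACA (\tr A *: _)) [X in _ ^+ _ *: X]addrACA.
    by rewrite scalerDr /= [LHS]addrACA.
  rewrite mulrnDl IHA IHB; do 4! [rewrite -big_split; apply: eq_bigr => ? _ /=].
  by rewrite linearD mulmxDr mulmxDl.
have -> : reduction_tens b (X *t Y) =
    (\tr X *: 1%:M + (-1) ^+ true *: X) *t (\tr Y *: 1%:M + (-1) ^+ b *: Y).
  rewrite /reduction_tens ptrace1_tens ptrace2_tens mxtrace_tens.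
  rewrite !tensmxDl !tensmxDr !tensmxZl !tensmxZr tens1mx1.
  rewrite expr1 !scaleN1r scalerBr !scalerA (mulrC ((-1) ^+ b)).
  by rewrite [LHS]addrACA.
rewrite -[4%N]/(2 * 2)%N -tensmx_mulrn.
rewrite -!sum_delta_sym tensmx_suml; apply: eq_bigr => i _.
rewrite tensmx_suml; apply: eq_bigr => j _.
rewrite tensmx_sumr; apply: eq_bigr => k _.
rewrite tensmx_sumr; apply: eq_bigr => l _.
by rewrite !trmx_tens !tensmx_mul.
Qed.

End PartialTraces.

(** * Hermitian matrices *)

Section Hermitian.
Context {C : numClosedFieldType}.

Lemma hermsymmxP {k : nat} (A : 'M[C]_k) :
  A \is hermsymmx <-> forall i j, A i j = (A j i)^*.
Proof.
split=> [/is_hermitianmxP|] hA.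
  by move=> i j; rewrite {1}hA expr0 scale1r !mxE.
by apply/is_hermitianmxP/matrixP => i j; rewrite expr0 scale1r !mxE.
Qed.

Lemma herm1 {k : nat} : (1%:M : 'M[C]_k) \is hermsymmx.
Proof. by apply/hermsymmxP => i j; rewrite !mxE eq_sym conjC_nat. Qed.

Lemma hermD {k : nat} (A B : 'M[C]_k) :
  A \is hermsymmx -> B \is hermsymmx -> A + B \is hermsymmx.
Proof.
move=> /hermsymmxP hA /hermsymmxP hB; apply/hermsymmxP => i j.
by rewrite !mxE hA hB rmorphD.
Qed.

Lemma hermN {k : nat} (A : 'M[C]_k) : A \is hermsymmx -> - A \is hermsymmx.
Proof.
by move=> /hermsymmxP hA; apply/hermsymmxP => i j; rewrite !mxE hA rmorphN.
Qed.

Lemma herm_tens {m n : nat} (X : 'M[C]_m) (Y : 'M[C]_n) :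
  X \is hermsymmx -> Y \is hermsymmx -> X *t Y \is hermsymmx.
Proof.
move=> /hermsymmxP hX /hermsymmxP hY; apply/hermsymmxP => i j.
by rewrite !mxE hX hY rmorphM.
Qed.

Lemma herm_trace {k : nat} (A : 'M[C]_k) :
  A \is hermsymmx -> \tr A *: (1%:M : 'M[C]_k) \is hermsymmx.
Proof.
move=> /hermsymmxP hA; apply/hermsymmxP => i j.
rewrite !mxE rmorphM /= conjC_nat eq_sym rmorph_sum; congr (_ * _).
by apply: eq_bigr => l _; rewrite [LHS]hA.
Qed.

End Hermitian.

(** * Positive semidefinite matrices *)

Section Positivity.
Context {R : realType}.
Local Open Scope sesquilinear_scope.

Lemma herm_ptrace1 {m n : nat} (A : 'M[R[i]]_(m * n)) :
  A \is hermsymmx -> ptrace1 A \is hermsymmx.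
Proof.
move=> /hermsymmxP hA; apply/hermsymmxP => i j.
rewrite !summxE rmorph_sum; apply: eq_bigr => l _.
by rewrite !mxE [LHS]hA.
Qed.

Lemma herm_ptrace2 {m n : nat} (A : 'M[R[i]]_(m * n)) :
  A \is hermsymmx -> ptrace2 A \is hermsymmx.
Proof.
move=> /hermsymmxP hA; apply/hermsymmxP => i j.
rewrite !mxE rmorph_sum; apply: eq_bigr => l _.
by rewrite !mxE [LHS]hA.
Qed.

Lemma psdmx0 {k : nat} : psdmx (0 : 'M[R[i]]_k).
Proof.
split=> [|x]; last by rewrite mulmx0 mul0mx mxE.
by apply/hermsymmxP => i j; rewrite !mxE rmorph0.
Qed.

Lemma psdmxD {k : nat} (A B : 'M[R[i]]_k) :
  psdmx A -> psdmx B -> psdmx (A + B).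
Proof.
move=> [hA pA] [hB pB]; split=> [|x]; first exact: hermD.
by rewrite mulmxDr mulmxDl mxE addr_ge0.
Qed.

Lemma psdmx_mulrn {k d : nat} (A : 'M[R[i]]_k) :
  A \is hermsymmx -> psdmx (A *+ d.+1) -> psdmx A.
Proof.
move=> hA [_ pA]; split=> [//|x]; move: (pA x).
by rewrite -scaler_nat -scalemxAr -scalemxAl mxE pmulr_rge0 ?ltr0Sn.
Qed.

(** With [y] the conjugate of [x], the number [x^* A^T x] equals [y^* A y],
being its own transpose. *)
Lemma psdmx_tr {k : nat} (A : 'M[R[i]]_k) : psdmx A -> psdmx A^T.
Proof.
move=> [/hermsymmxP hA pA]; split=> [|x].
  by apply/hermsymmxP => i j; rewrite !mxE [LHS]hA.
pose y := map_mx Num.conj x.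
suff -> : x ^t* *m A^T *m x = (y ^t* *m A *m y)^T by rewrite mxE; apply: pA.
rewrite !trmx_mul mulmxA; congr (_ *m _ *m _); first by rewrite map_trmx.
by apply/matrixP=> i j; rewrite !mxE conjCK.
Qed.

Lemma psdmx_congr {k l : nat} (W : 'M[R[i]]_(l, k)) (A : 'M[R[i]]_k) :
  psdmx A -> psdmx (W *m A *m W ^t*).
Proof.
have adjM (p q r : nat) (U : 'M[R[i]]_(p, q)) (V : 'M[R[i]]_(q, r)) :
  (U *m V)^t* = V^t* *m U^t* by rewrite trmx_mul map_mxM.
have adjK (p q : nat) (U : 'M[R[i]]_(p, q)) : U^t*^t* = U.
  by apply/matrixP=> i j; rewrite !mxE conjCK.
move=> [/is_hermitianmxP hA pA]; split=> [|x].
  apply/is_hermitianmxP; rewrite expr0 scale1r in hA; rewrite expr0.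
  by rewrite scale1r !adjM adjK -hA mulmxA.
by move: (pA (W^t* *m x)); rewrite adjM adjK !mulmxA.
Qed.

Lemma conj_delta_sym {k : nat} b (i j : 'I_k) :
  map_mx Num.conj (delta_sym b i j : 'M[R[i]]_k) = delta_sym b i j.
Proof.
apply/matrixP=> p q.
by rewrite !mxE rmorphD rmorphM /= !conjC_nat rmorph_sign.
Qed.

Lemma psdmx_reduction_tens {m n : nat} b (A : 'M[R[i]]_(m * n)) :
  psdmx A -> psdmx (reduction_tens b A *+ 4).
Proof.
move=> pA; rewrite reduction_tensE.
do 4! [apply: big_ind => [||? _]; [exact: psdmx0|exact: psdmxD|]].
set W := _ *t _.
(* [W] is real, so that the transposed form is an honest congruence. *)
have -> : W^T = W^t* by rewrite -map_trmx map_mxT !conj_delta_sym.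
exact/psdmx_congr/psdmx_tr.
Qed.

End Positivity.

Theorem theorem2p2 (R : realType) (m n : nat) (hm : (1 <= m)%N) (hn : (1 <= n)%N)
    (A : 'M[R[i]]_(m * n)) (hA : psdmx A) :
  loewner_ge (\tr A *: 1%:M - ptrace2 A *t 1%:M) (1%:M *t ptrace1 A - A) /\
  loewner_ge (\tr A *: 1%:M - ptrace2 A *t 1%:M) (- (1%:M *t ptrace1 A - A)).
Proof.
have [hermA _] := hA.
have hX : \tr A *: 1%:M - ptrace2 A *t (1%:M : 'M_n) \is hermsymmx.
  by apply: hermD; [exact: herm_trace|apply/hermN/herm_tens/herm1/herm_ptrace2].
have hY : (1%:M : 'M_m) *t ptrace1 A - A \is hermsymmx.
  by apply: hermD; [apply/herm_tens/herm_ptrace1/hermA/herm1|exact: hermN].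
have hNY := hermN _ hY.
split; split; [exact: hX|exact: hY| |exact: hX|exact: hNY|].
  (* The sign + of the statement takes [s = -1], since the right side is
     subtracted; [d := 3] is the factor 4 of [reduction_tensE]. *)
  apply: (psdmx_mulrn (d := 3) _ (hermD _ _ hX hNY)).
  have := psdmx_reduction_tens true A hA.
  by rewrite /reduction_tens expr1 scaleN1r; apply.
apply: (psdmx_mulrn (d := 3) _ (hermD _ _ hX (hermN _ hNY))).
have := psdmx_reduction_tens false A hA.
by rewrite /reduction_tens expr0 scale1r opprK; apply.
Qed.
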